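(* Let $\varepsilon>1$, $\theta>0$, $\gamma\in(0,1]$, $C>0$. Assume that customers care about fairness according to the fairness function $$F(M^p)=1-\theta\left(M^p-\frac{\varepsilon}{\varepsilon-1}\right),$$ infer costs subproportionally, i.e. $C^p(P)=(C^b)^{\gamma}\left(\frac{\varepsilon-1}{\varepsilon}P\right)^{1-\gamma}$, and are acclimated, i.e. $C^b$ is such that at the monopoly's optimal price $M^p=\varepsilon/(\varepsilon-1)$ (so $F=1$). Then the monopoly's markup is $$M=1+\frac{1}{(1+\gamma\theta)\varepsilon-1}.$$ The markup decreases with $\varepsilon$, $\theta$, and $\gamma$. And the cost passthrough $\beta=\frac{d\ln P}{d\ln C}$ (with $C^b$ held fixed, evaluated at the acclimated situation) is $$\beta=\frac{1}{1+\dfrac{\gamma^{2}\theta\,[(1+\theta)\varepsilon-1]}{(\varepsilon-1)(1+\gamma\theta)\,[(1+\gamma\theta)\varepsilon-1]}}.$$ The passthrough increases with $\varepsilon$; it decreases with $\theta$ and $\gamma$.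
   Context: Monopoly model. A monopoly with constant marginal cost $C>0$ sells a good at a single price $P$ to a representative customer, who does not observe $C$ but perceives a marginal cost $C^p(P)$ and hence a markup $M^p(P)=P/C^p(P)$. The constant $C^b>0$ is a prior point belief about marginal cost. The customer chooses $Y$ to maximize $\frac{\varepsilon}{\varepsilon-1}(F\cdot Y)^{(\varepsilon-1)/\varepsilon}+W-P\cdot Y$, where $W>0$ is wealth and $F=F(M^p(P))$ is taken as given; this gives the demand curve $Y^d(P)=P^{-\varepsilon}F(M^p(P))^{\varepsilon-1}$. The monopoly chooses $P$ to maximize $(P-C)\,Y^d(P)$ over prices $P>C$ with $F(M^p(P))>0$. The markup is $M=P/C$ at the optimal price. $\varepsilon$ measures the competitiveness of the market, $\theta$ the concern for fairness, $\gamma$ the degree of underinference. *)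

(* Defs.v *)
From Stdlib Require Import Reals.
From Coquelicot Require Import Coquelicot.

(* [Rpower x y] is exp (y * ln x),
   hence the usual power only for x > 0; every base below is positive at the
   prices where the definitions are used. *)

Open Scope R_scope.

Definition fairness (eps theta Mp : R) : R :=
  1 - theta * (Mp - eps / (eps - 1)).

Definition perceived_cost (eps gamma Cb P : R) : R :=
  Rpower Cb gamma * Rpower ((eps - 1) / eps * P) (1 - gamma).

Definition perceived_markup (eps gamma Cb P : R) : R :=
  P / perceived_cost eps gamma Cb P.

Definition fairness_at (eps theta gamma Cb P : R) : R :=
  fairness eps theta (perceived_markup eps gamma Cb P).

(* Demand of a customer maximizing over Y
     eps / (eps - 1) * (F * Y) ^ ((eps - 1) / eps) + W - P * Y
   with F = fairness_at eps theta gamma Cb P taken as given. *)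
Definition demand (eps theta gamma Cb P : R) : R :=
  Rpower P (- eps) * Rpower (fairness_at eps theta gamma Cb P) (eps - 1).

Definition profit (eps theta gamma C Cb P : R) : R :=
  (P - C) * demand eps theta gamma Cb P.

Definition admissible (eps theta gamma C Cb P : R) : Prop :=
  C < P /\ 0 < fairness_at eps theta gamma Cb P.

Definition optimal_price (eps theta gamma C Cb P : R) : Prop :=
  admissible eps theta gamma C Cb P /\
  forall Q : R, admissible eps theta gamma C Cb Q ->
    profit eps theta gamma C Cb Q <= profit eps theta gamma C Cb P.

(* The prior belief [Cb] and the price [P] form an acclimated situation at
   marginal cost [C]. *)
Definition acclimated (eps theta gamma C Cb P : R) : Prop :=
  0 < Cb /\
  optimal_price eps theta gamma C Cb P /\
  perceived_markup eps gamma Cb P = eps / (eps - 1).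

Definition markup (C P : R) : R := P / C.

(* d ln P / d ln C = beta at [C], with [Cb] held fixed: for costs c near [C]
   the optimal price exists and is unique, and the resulting function
   ln c |-> ln (Popt c) has derivative [beta] at ln C.  Acclimation is not
   imposed at c <> C. *)
Definition is_passthrough (eps theta gamma C Cb beta : R) : Prop :=
  exists Popt : R -> R,
    locally C (fun c : R =>
      forall Q : R, optimal_price eps theta gamma c Cb Q <-> Q = Popt c) /\
    is_derive (fun x : R => ln (Popt (exp x))) (ln C) beta.

(* Main.v *)
(* In the log price [x = ln P] the log profit is
   [ln (e^x - c) - eps x + (eps - 1) ln F], and its derivative is
   [P / (P - c) - E], where [E] is the price elasticity of demand.  Since [F]
   decreases and the perceived markup increases with [x], so does [E]; the
   first-order condition, solved for the cost, reads
   [ln c = x + ln (1 - 1 / E)], whose right-hand side is strictly increasing.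
   It therefore characterizes the optimal price, and the passthrough is the
   derivative of the inverse function, [1 / (1 + E' / (E (E - 1)))].
   Acclimation makes [F = 1] and [E = (1 + gamma theta) eps]. *)

Require Import Defs.
From Stdlib Require Import Reals Lra ClassicalEpsilon Ranalysis5.
From Coquelicot Require Import Coquelicot.
Open Scope R_scope.

(** * Differentiability of local inverses of real functions *)

(** The difference quotient of [g] at [h x] is the reciprocal of that of [h] at [x], taken at the
    increment [s] of [g]; continuity of [g] makes [s] small. *)
Lemma is_derive_local_inverse (h g : R -> R) (x d : R) :
  0 < d -> is_derive h x d -> g (h x) = x -> continuous g (h x) ->
  locally (h x) (fun y => h (g y) = y) -> is_derive g (h x) (/ d).
Proof.
intros Hd Hh Hgx Hg Hinv.
apply is_derive_Reals in Hh.
apply is_derive_Reals; intros e He.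
(* With [q] the quotient of [h], the bound [d / 2] gives [q * d >= d * d / 2]; the second bound then
   makes [(d - q) / (q * d)] smaller than [e] in absolute value. *)
assert (Hm : 0 < Rmin (d / 2) (e * (d * d) / 4)).
{ assert (0 < e * (d * d)) by (repeat apply Rmult_lt_0_compat; lra).
  apply Rmin_pos; lra. }
destruct (Hh _ Hm) as [[del Hdel] Hq]; simpl in Hq.
assert (Hball : locally (h x) (fun y => Rabs (g y - x) < del)).
{ apply (Hg (fun z => Rabs (z - x) < del)).
  exists (mkposreal del Hdel); intros z Hz.
  rewrite Hgx in Hz; exact Hz. }
destruct (filter_and _ _ Hinv Hball) as [r Hr].
exists r; intros k Hk0 Hk.
destruct (Hr (h x + k)) as [Hy Hs].
{ change (Rabs (h x + k - h x) < r).
  now replace (h x + k - h x) with k by ring. }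
rewrite Hgx.
set (s := g (h x + k) - x) in *.
assert (Hxs : g (h x + k) = x + s) by (unfold s; ring).
rewrite Hxs in Hy.
assert (Hs0 : s <> 0).
{ intros E; rewrite E, Rplus_0_r in Hy; lra. }
specialize (Hq s Hs0 Hs).
replace (h (x + s) - h x) with k in Hq by lra.
set (q := k / s) in *.
assert (Hq1 := Rlt_le_trans _ _ _ Hq (Rmin_l _ _)).
assert (Hq2 := Rlt_le_trans _ _ _ Hq (Rmin_r _ _)).
apply Rabs_def2 in Hq1.
assert (Hqpos : 0 < q) by lra.
replace (s / k - / d) with ((d - q) * / (q * d)).
2:{ unfold q; field; repeat split; lra. }
assert (Hqd : 0 < q * d) by nra.
rewrite Rabs_mult, (Rabs_pos_eq (/ (q * d)))
  by (left; now apply Rinv_0_lt_compat).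
rewrite Rabs_minus_sym.
apply Rmult_lt_reg_r with (q * d); [easy|].
rewrite Rmult_assoc, Rinv_l, Rmult_1_r by lra.
assert (d * d / 2 <= q * d) by nra.
nra.
Qed.

(** The intermediate value theorem supplies preimages in [(a, b)]; strict monotonicity makes them
    unique and the inverse continuous at [h x]. *)
Lemma increasing_local_inverse (h : R -> R) (a b x d : R) :
  a < x < b ->
  (forall y z, a < y -> y < z -> z < b -> h y < h z) ->
  (forall y, a < y < b -> continuity_pt h y) ->
  0 < d -> is_derive h x d ->
  exists g : R -> R,
    locally (h x) (fun y => a < g y < b /\ h (g y) = y) /\
    is_derive g (h x) (/ d).
Proof.
intros Hx Hmono Hcont Hd Hder.
(* Where no preimage exists in [(a, b)] the value of [g] is unspecified; only points near [h x]
   matter. *)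
set (g := fun y => epsilon (inhabits 0) (fun z => a < z < b /\ h z = y)).
assert (Hinj : forall y z, a < y < b -> a < z < b -> h y < h z -> y < z).
{ intros y z Hy Hz Hyz; destruct (Rtotal_order y z) as [H|[H|H]]; auto.
  - subst; lra.
  - assert (h z < h y) by (apply Hmono; lra); lra. }
assert (Hsol : forall y z, a < y -> y < z -> z < b -> forall w,
  h y < w < h z -> (a < g w < b /\ h (g w) = w) /\ y < g w < z).
{ intros y z Hy Hyz Hz w Hw.
  assert (Hg : a < g w < b /\ h (g w) = w).
  { unfold g; apply epsilon_spec.
    destruct (f_interv_is_interv h y z w Hyz) as [v [Hv Hhv]].
    - lra.
    - intros t Ht; apply Hcont; lra.
    - exists v; split; [lra | easy]. }
  split; [easy|].
  destruct Hg as [Hg1 Hg2]; split; apply Hinj; lra. }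
assert (Hnbhd : forall y z, a < y < x -> x < z < b ->
  locally (h x) (fun w => h y < w < h z)).
{ intros y z Hy Hz.
  apply (open_and (fun w => h y < w) (fun w => w < h z)).
  - apply open_gt.
  - apply open_lt.
  - split; apply Hmono; lra. }
assert (Hloc : locally (h x) (fun y => a < g y < b /\ h (g y) = y)).
{ apply filter_imp with (2 := Hnbhd ((a + x) / 2) ((x + b) / 2)
    ltac:(lra) ltac:(lra)).
  intros w Hw.
  apply (Hsol ((a + x) / 2) ((x + b) / 2)); lra. }
exists g; split; [easy|].
assert (Hgx : g (h x) = x).
{ destruct (locally_singleton _ _ Hloc) as [H1 H2].
  destruct (Rtotal_order (g (h x)) x) as [H|[H|H]]; auto.
  - assert (h (g (h x)) < h x) by (apply Hmono; lra); lra.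
  - assert (h x < h (g (h x))) by (apply Hmono; lra); lra. }
apply is_derive_local_inverse; auto.
- intros Q HQ; rewrite Hgx in HQ.
  destruct HQ as [r Hr].
  (* The points [y] and [z] enclose [x] within the ball of radius [r]; the midpoints with [a] and
     [b] keep them inside [(a, b)]. Then [g] maps [(h y, h z)] into the ball. *)
  set (y := Rmax ((a + x) / 2) (x - r / 2)).
  set (z := Rmin ((x + b) / 2) (x + r / 2)).
  assert (Hr0 := cond_pos r).
  assert (Hy : a < y < x /\ x - r / 2 <= y).
  { unfold y; split; [split|].
    - apply Rlt_le_trans with (2 := Rmax_l _ _); lra.
    - apply Rmax_lub_lt; lra.
    - apply Rmax_r. }
  assert (Hz : x < z < b /\ z <= x + r / 2).
  { unfold z; split; [split|].
    - apply Rmin_glb_lt; lra.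
    - apply Rle_lt_trans with (1 := Rmin_l _ _); lra.
    - apply Rmin_r. }
  apply filter_imp with (2 := Hnbhd y z ltac:(lra) ltac:(lra)).
  intros w Hw; apply Hr.
  destruct (Hsol y z ltac:(lra) ltac:(lra) ltac:(lra) w Hw) as [_ H].
  apply Rabs_def1; unfold minus, plus, opp; simpl; lra.
- apply filter_imp with (2 := Hloc); tauto.
Qed.

(** * Perceived markup, fairness, elasticity and log cost as functions of the log price *)

Section LogPrice.

Variables eps theta gamma Cb : R.
Hypothesis Heps : 1 < eps.
Hypothesis Htheta : 0 < theta.
Hypothesis Hgamma : 0 < gamma.

Definition mp (x : R) : R := perceived_markup eps gamma Cb (exp x).

Definition fair (x : R) : R := fairness_at eps theta gamma Cb (exp x).

(* Minus the derivative of [ln demand] with respect to the log price. *)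
Definition elasticity (x : R) : R :=
  eps + (eps - 1) * (theta * gamma * mp x / fair x).

(* The log cost at which the log price [x] satisfies the first-order
   condition. *)
Definition log_cost (x : R) : R := x + ln (1 - 1 / elasticity x).

Definition log_profit (c x : R) : R :=
  ln (exp x - c) - eps * x + (eps - 1) * ln (fair x).

(** Subproportional inference makes the perceived markup proportional to [P ^ gamma], hence
    log-linear in the log price with slope [gamma]. Sign, monotonicity and derivative are read off
    this form. *)
Lemma mp_exp (x : R) :
  mp x = exp (gamma * x - gamma * ln Cb - (1 - gamma) * ln ((eps - 1) / eps)).
Proof.
unfold mp, perceived_markup, perceived_cost, Rpower.
rewrite ln_mult, ln_exp; [| apply Rdiv_lt_0_compat; lra | apply exp_pos].
unfold Rdiv at 1; rewrite <- exp_plus, <- exp_Ropp, <- exp_plus.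
f_equal; ring.
Qed.

Lemma mp_pos (x : R) : 0 < mp x.
Proof. rewrite mp_exp; apply exp_pos. Qed.

Lemma mp_lt (x y : R) : x < y -> mp x < mp y.
Proof. intros H; rewrite !mp_exp; apply exp_increasing; nra. Qed.

Lemma is_derive_mp (x : R) : is_derive mp x (gamma * mp x).
Proof.
eapply is_derive_ext.
- intros t; symmetry; apply mp_exp.
- rewrite mp_exp; auto_derive; [easy | unfold Rminus; ring].
Qed.

Lemma is_derive_fair (x : R) : is_derive fair x (- (theta * gamma * mp x)).
Proof.
unfold fair, fairness_at, fairness.
change (is_derive (fun t => 1 - theta * (mp t - eps / (eps - 1))) x
          (- (theta * gamma * mp x))).
assert (H := is_derive_mp x).
auto_derive.
- now exists (gamma * mp x).
- replace (Derive (fun t => mp t) x) with (gamma * mp x)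
    by (symmetry; now apply is_derive_unique).
  ring.
Qed.

Lemma fair_lt (x y : R) : x < y -> fair y < fair x.
Proof.
intros H; apply mp_lt in H.
unfold fair, fairness_at, fairness.
change (1 - theta * (mp y - eps / (eps - 1)) <
        1 - theta * (mp x - eps / (eps - 1))).
nra.
Qed.

Lemma fair_pos_locally (x : R) :
  0 < fair x -> locally x (fun y => 0 < fair y).
Proof.
intros H.
assert (Hc : continuous fair x)
  by (apply (ex_derive_continuous fair); eexists; apply is_derive_fair).
apply (Hc (fun z => 0 < z)), open_gt, H.
Qed.

Lemma elasticity_gt (x : R) : 0 < fair x -> eps < elasticity x.
Proof.
intros H; unfold elasticity.
assert (Hm := mp_pos x).
assert (0 < theta * gamma * mp x / fair x).
{ apply Rdiv_lt_0_compat; [|easy].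
  apply Rmult_lt_0_compat; nra. }
nra.
Qed.

Lemma elasticity_lt (x y : R) :
  x < y -> 0 < fair y -> elasticity x < elasticity y.
Proof.
intros Hxy Hy.
assert (Hf := fair_lt _ _ Hxy).
assert (Hm := mp_lt _ _ Hxy).
assert (Hm0 := mp_pos x).
assert (Htg : 0 < theta * gamma) by nra.
unfold elasticity, Rdiv.
apply Rplus_lt_compat_l, Rmult_lt_compat_l; [lra|].
apply Rle_lt_trans with (theta * gamma * mp x * / fair y).
- apply Rmult_le_compat_l; [nra|].
  apply Rinv_le_contravar; lra.
- apply Rmult_lt_compat_r; [now apply Rinv_0_lt_compat | nra].
Qed.

Lemma is_derive_elasticity (x : R) :
  0 < fair x ->
  is_derive elasticity x
    ((eps - 1) * theta * gamma ^ 2 * mp x * (fair x + theta * mp x)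
     / fair x ^ 2).
Proof.
intros H; unfold elasticity.
assert (Hm := is_derive_mp x).
assert (Hf := is_derive_fair x).
auto_derive.
- repeat split; [eexists; apply Hm | eexists; apply Hf | lra].
- replace (Derive (fun t => mp t) x) with (gamma * mp x)
    by (symmetry; now apply is_derive_unique).
  replace (Derive (fun t => fair t) x) with (- (theta * gamma * mp x))
    by (symmetry; now apply is_derive_unique).
  field; lra.
Qed.

(** At the first-order condition [1 / elasticity x] is the Lerner index [(P - c) / P]. An elasticity
    above [eps > 1] puts it strictly between 0 and 1, so the logarithm in [log_cost] has a positive
    argument. *)
Lemma lerner_bounds (x : R) :
  0 < fair x -> 0 < 1 - 1 / elasticity x < 1.
Proof.
intros H; apply elasticity_gt in H.
assert (H0 : 0 < 1 / elasticity x) by (apply Rdiv_lt_0_compat; lra).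
assert (1 / elasticity x < 1).
{ apply Rmult_lt_reg_r with (elasticity x); [lra|].
  unfold Rdiv; rewrite Rmult_assoc, Rinv_l; lra. }
lra.
Qed.

Lemma log_cost_lt (x y : R) : x < y -> 0 < fair y -> log_cost x < log_cost y.
Proof.
intros Hxy Hy.
assert (Hx : 0 < fair x) by (assert (H := fair_lt _ _ Hxy); lra).
unfold log_cost; apply Rplus_lt_compat; [easy|].
apply ln_increasing; [now apply lerner_bounds|].
assert (/ elasticity y < / elasticity x).
{ assert (H := elasticity_gt _ Hx); assert (H' := elasticity_lt _ _ Hxy Hy).
  apply Rinv_lt_contravar; [nra | easy]. }
unfold Rdiv; lra.
Qed.

Lemma log_cost_inj (x y : R) :
  0 < fair x -> 0 < fair y -> log_cost x = log_cost y -> x = y.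
Proof.
intros Hx Hy E; destruct (Rtotal_order x y) as [H|[H|H]]; auto.
- assert (H1 := log_cost_lt _ _ H Hy); lra.
- assert (H1 := log_cost_lt _ _ H Hx); lra.
Qed.

Lemma is_derive_log_cost (x d : R) :
  0 < fair x -> is_derive elasticity x d ->
  is_derive log_cost x (1 + d / (elasticity x * (elasticity x - 1))).
Proof.
intros H Hd; unfold log_cost.
assert (Hl := lerner_bounds x H).
assert (He := elasticity_gt x H).
auto_derive.
- repeat split; [eexists; apply Hd | lra | unfold Rdiv in Hl; lra].
- replace (Derive (fun t => elasticity t) x) with d
    by (symmetry; now apply is_derive_unique).
  field; lra.
Qed.

Lemma exp_log_cost (x : R) :
  0 < fair x -> exp (log_cost x) = exp x * (1 - 1 / elasticity x).
Proof.
intros H; unfold log_cost.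
now rewrite exp_plus, exp_ln by now apply lerner_bounds.
Qed.

(** * Log profit and the first-order condition *)

Lemma profit_exp (c x : R) :
  admissible eps theta gamma c Cb (exp x) ->
  profit eps theta gamma c Cb (exp x) = exp (log_profit c x).
Proof.
intros [H1 H2]; unfold profit, demand, Rpower, log_profit, fair.
rewrite ln_exp.
replace (exp x - c) with (exp (ln (exp x - c))) at 1 by (apply exp_ln; lra).
rewrite <- !exp_plus; f_equal; ring.
Qed.

Lemma is_derive_log_profit (c x : R) :
  c < exp x -> 0 < fair x ->
  is_derive (log_profit c) x (exp x / (exp x - c) - elasticity x).
Proof.
intros Hc H; unfold log_profit.
assert (Hf := is_derive_fair x).
auto_derive.
- repeat split; [lra | eexists; apply Hf | easy].
- replace (Derive (fun t => fair t) x) with (- (theta * gamma * mp x))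
    by (symmetry; now apply is_derive_unique).
  unfold elasticity; field; lra.
Qed.

(** The hypothesis on [log_cost] says [exp x * (1 - 1 / E) <= c] with [E = elasticity x], which
    rearranges to [(exp x - c) * E <= exp x]: below the critical price, log profit does not fall. *)
Lemma log_profit_foc_pos (c x : R) :
  0 < c < exp x -> 0 < fair x ->
  log_cost x <= ln c -> 0 <= exp x / (exp x - c) - elasticity x.
Proof.
intros Hc H Hle.
assert (He := elasticity_gt x H).
assert (Hk : exp x * (1 - 1 / elasticity x) <= c).
{ rewrite <- exp_log_cost, <- (exp_ln c) by easy.
  destruct Hle as [Hlt|Heq];
    [left; now apply exp_increasing | right; now f_equal]. }
assert (Hk' : (exp x - c) * elasticity x <= exp x).
{ replace (exp x) with (exp x * (1 / elasticity x) * elasticity x) at 2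
    by (field; lra).
  apply Rmult_le_compat_r; lra. }
apply Rle_minus_r; rewrite Rplus_0_l.
apply Rmult_le_reg_r with (exp x - c); [lra|].
unfold Rdiv; rewrite Rmult_assoc, Rinv_l; lra.
Qed.

Lemma log_profit_foc_neg (c x : R) :
  0 < c < exp x -> 0 < fair x ->
  ln c <= log_cost x -> exp x / (exp x - c) - elasticity x <= 0.
Proof.
intros Hc H Hle.
assert (He := elasticity_gt x H).
assert (Hk : c <= exp x * (1 - 1 / elasticity x)).
{ rewrite <- exp_log_cost, <- (exp_ln c) by easy.
  destruct Hle as [Hlt|Heq];
    [left; now apply exp_increasing | right; now f_equal]. }
assert (Hk' : exp x <= (exp x - c) * elasticity x).
{ replace (exp x) with (exp x * (1 / elasticity x) * elasticity x) at 1
    by (field; lra).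
  apply Rmult_le_compat_r; lra. }
apply Rle_minus_l; rewrite Rplus_0_l.
apply Rmult_le_reg_r with (exp x - c); [lra|].
unfold Rdiv; rewrite Rmult_assoc, Rinv_l; lra.
Qed.

Lemma log_cost_of_foc (c x : R) :
  0 < c < exp x -> 0 < fair x ->
  exp x / (exp x - c) - elasticity x = 0 -> log_cost x = ln c.
Proof.
intros Hc H E.
assert (He := elasticity_gt x H).
apply exp_inv; rewrite exp_log_cost, exp_ln by easy.
assert (E' : elasticity x = exp x / (exp x - c)) by lra.
rewrite E'; field; lra.
Qed.

(** By the mean value theorem the profit gap is the slope at an intermediate [t] times [y - x]. As
    [log_cost] is increasing, the side of [x] on which [t] lies fixes the sign of that slope. *)
Lemma log_profit_max (c x y : R) :
  0 < c < exp x -> 0 < fair x -> log_cost x = ln c ->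
  c < exp y -> 0 < fair y -> log_profit c y <= log_profit c x.
Proof.
intros Hcx Hx E Hcy Hy.
(* Admissible log prices form an interval: the cost bound is inherited from the left end and
   positive fairness from the right end. *)
assert (Hin : forall t, Rmin x y <= t <= Rmax x y -> c < exp t /\ 0 < fair t).
{ intros t [H1 H2]; split.
  - apply Rlt_le_trans with (exp (Rmin x y)).
    + unfold Rmin; destruct Rle_dec; lra.
    + destruct H1 as [H1|H1];
        [left; now apply exp_increasing | right; now f_equal].
  - apply Rlt_le_trans with (fair (Rmax x y)).
    + unfold Rmax; destruct Rle_dec; lra.
    + destruct H2 as [H2|H2];
        [left; now apply fair_lt | right; now f_equal]. }
destruct (MVT_gen (log_profit c) x y
            (fun t => exp t / (exp t - c) - elasticity t)) as [t [Ht Et]].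
- intros t Ht; destruct (Hin t) as [H1 H2]; [lra|].
  now apply is_derive_log_profit.
- intros t Ht; destruct (Hin t Ht) as [H1 H2].
  apply continuity_pt_filterlim, (ex_derive_continuous (log_profit c)).
  eexists; now apply is_derive_log_profit.
- destruct (Hin t Ht) as [H1 H2].
  enough ((exp t / (exp t - c) - elasticity t) * (y - x) <= 0) by lra.
  destruct (Rle_dec x y) as [Hxy|Hxy].
  + rewrite Rmin_left, Rmax_right in Ht by lra.
    assert (exp t / (exp t - c) - elasticity t <= 0); [|nra].
    apply log_profit_foc_neg; [lra | easy |].
    rewrite <- E; destruct (proj1 Ht) as [Hlt|Heq].
    * left; now apply log_cost_lt.
    * right; now f_equal.
  + rewrite Rmin_right, Rmax_left in Ht by lra.
    assert (0 <= exp t / (exp t - c) - elasticity t); [|nra].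
    apply log_profit_foc_pos; [lra | easy |].
    rewrite <- E; destruct (proj2 Ht) as [Hlt|Heq].
    * left; now apply log_cost_lt.
    * right; now f_equal.
Qed.

(** Necessity is Fermat's rule for log profit at an interior maximum; sufficiency is
    [log_profit_max]. *)
Lemma optimal_price_iff (c P : R) :
  0 < c ->
  optimal_price eps theta gamma c Cb P <->
  0 < P /\ 0 < fair (ln P) /\ log_cost (ln P) = ln c.
Proof.
intros Hc; split.
- intros [[HcP HF] Hmax].
  assert (HP : 0 < P) by lra.
  set (x := ln P).
  assert (Hx : exp x = P) by now apply exp_ln.
  rewrite <- Hx in HcP, HF, Hmax; clearbody x.
  split; [easy | split; [easy|]].
  apply log_cost_of_foc; [lra | easy |].
  (* Admissibility is an open condition, so the maximum is interior. *)
  assert (Hloc : locally x (fun y => c < exp y /\ 0 < fair y)).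
  { apply filter_and; [| now apply fair_pos_locally].
    apply (continuous_exp x (fun z => c < z)), open_gt, HcP. }
  destruct Hloc as [[r Hr] Hloc]; simpl in Hloc.
  assert (Hd := is_derive_log_profit c x HcP HF).
  assert (Hd' := Hd); apply is_derive_Reals in Hd'.
  pose (pr := exist _ _ Hd' : derivable_pt (log_profit c) x).
  transitivity (derive_pt (log_profit c) x pr); [easy|].
  apply deriv_maximum with (a := x - r) (b := x + r); [lra | lra |].
  intros y Hy1 Hy2.
  destruct (Hloc y) as [Hcy Hfy].
  { apply Rabs_def1; unfold minus, plus, opp; simpl; lra. }
  assert (Hle := Hmax (exp y) (conj Hcy Hfy)).
  rewrite !profit_exp in Hle by now split.
  destruct (Rle_lt_dec (log_profit c y) (log_profit c x)) as [H|H]; [easy|].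
  apply exp_increasing in H; lra.
- intros [HP [HF HE]].
  set (x := ln P) in *.
  assert (Hx : exp x = P) by now apply exp_ln.
  rewrite <- Hx; clearbody x.
  (* The first-order condition writes [c] as the price times a factor below one. *)
  assert (Hcx : c < exp x).
  { rewrite <- (exp_ln c), <- HE, exp_log_cost by easy.
    assert (Hl := lerner_bounds x HF); assert (H := exp_pos x); nra. }
  assert (Hadm : admissible eps theta gamma c Cb (exp x)) by now split.
  split; [easy|].
  intros Q HQ; assert (HQ0 : 0 < Q) by (destruct HQ; lra).
  rewrite <- (exp_ln Q) in HQ |- * by easy.
  rewrite !profit_exp by easy.
  destruct HQ as [HQ1 HQ2].
  destruct (log_profit_max c x (ln Q)) as [H|H]; auto.
  + left; now apply exp_increasing.
  + right; now f_equal.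
Qed.

(** * Existence and uniqueness of the passthrough *)

Lemma is_passthrough_inv_log_cost (C P d : R) :
  0 < C -> optimal_price eps theta gamma C Cb P ->
  0 < d -> is_derive log_cost (ln P) d ->
  is_passthrough eps theta gamma C Cb (/ d).
Proof.
intros HC Hopt Hd Hder.
apply optimal_price_iff in Hopt as [HP [HF HE]]; [|easy].
set (x := ln P) in *.
destruct (fair_pos_locally x HF) as [[r Hr] Hloc]; simpl in Hloc.
(* On this interval fairness stays positive, so [log_cost] is strictly increasing and differentiable
   there. *)
assert (Hfair : forall y, x - r < y < x + r -> 0 < fair y).
{ intros y Hy; apply Hloc, Rabs_def1; unfold minus, plus, opp; simpl; lra. }
destruct (increasing_local_inverse log_cost (x - r) (x + r) x d)
  as [g [Hg Hdg]]; auto.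
- lra.
- intros y z H1 H2 H3; apply log_cost_lt; [easy | apply Hfair; lra].
- intros y Hy; apply Hfair in Hy.
  apply continuity_pt_filterlim, (ex_derive_continuous log_cost).
  eexists; apply is_derive_log_cost; [easy | now apply is_derive_elasticity].
- rewrite HE in Hg, Hdg.
  (* The inverse [g] of [log_cost] sends the log cost to the optimal log price. *)
  exists (fun c => exp (g (ln c))); split.
  + assert (Hln : continuous ln C)
      by (apply (ex_derive_continuous ln); eexists; now apply is_derive_ln).
    apply Hln in Hg; unfold filtermap in Hg.
    assert (HC' : locally C (fun c => 0 < c)) by exact (open_gt 0 C HC).
    apply filter_imp with (2 := filter_and _ _ Hg HC').
    intros c [[Hgc Elc] Hc0] Q.
    apply Hfair in Hgc.
    rewrite optimal_price_iff by easy; split.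
    (* The log of [Q] may lie outside the interval; injectivity of [log_cost] wherever fairness is
       positive still identifies it with [g (ln c)]. *)
    * intros [HQ [HFQ HEQ]].
      rewrite <- (exp_ln Q) by easy; f_equal.
      apply log_cost_inj; congruence.
    * intros ->; rewrite ln_exp; repeat split; [apply exp_pos | easy | easy].
  + apply is_derive_ext with (2 := Hdg).
    intros y; now rewrite !ln_exp.
Qed.

End LogPrice.

(** Near [C] the optimal price determines the price function, so both derivatives are of the same
    germ. This turns claims about an arbitrary passthrough into claims about the closed formula. *)
Lemma is_passthrough_unique (eps theta gamma C Cb beta beta' : R) :
  0 < C ->
  is_passthrough eps theta gamma C Cb beta ->
  is_passthrough eps theta gamma C Cb beta' -> beta = beta'.
Proof.
intros HC [p [Hp Hd]] [q [Hq Hd']].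
assert (Hexp : continuous exp (ln C)) by apply continuous_exp.
assert (Hpq := filter_and _ _ Hp Hq).
rewrite <- (exp_ln C) in Hpq by easy.
apply Hexp in Hpq; unfold filtermap in Hpq.
assert (Hdq : is_derive (fun x => ln (q (exp x))) (ln C) beta).
{ apply is_derive_ext_loc with (2 := Hd).
  apply filter_imp with (2 := Hpq).
  intros y [Hpy Hqy]; f_equal.
  apply Hqy, Hpy; reflexivity. }
rewrite <- (is_derive_unique _ _ _ Hdq).
now apply is_derive_unique.
Qed.

(** * Markup and passthrough in the acclimated situation *)

Definition acclimated_passthrough (eps theta gamma : R) : R :=
  1 / (1 + gamma ^ 2 * theta * ((1 + theta) * eps - 1)
           / ((eps - 1) * (1 + gamma * theta)
              * ((1 + gamma * theta) * eps - 1))).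

Section Acclimated.

Variables eps theta gamma C Cb P : R.
Hypothesis Heps : 1 < eps.
Hypothesis Htheta : 0 < theta.
Hypothesis Hgamma : 0 < gamma.
Hypothesis HC : 0 < C.
Hypothesis Hacc : acclimated eps theta gamma C Cb P.

Lemma acclimated_price_pos : 0 < P.
Proof. destruct Hacc as [_ [[[H _] _] _]]; lra. Qed.

Lemma acclimated_mp : mp eps gamma Cb (ln P) = eps / (eps - 1).
Proof.
unfold mp; rewrite exp_ln by apply acclimated_price_pos; apply Hacc.
Qed.

Lemma acclimated_fair : fair eps theta gamma Cb (ln P) = 1.
Proof.
unfold fair, fairness_at, fairness.
change (1 - theta * (mp eps gamma Cb (ln P) - eps / (eps - 1)) = 1).
rewrite acclimated_mp; ring.
Qed.

Lemma acclimated_elasticity :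
  elasticity eps theta gamma Cb (ln P) = (1 + gamma * theta) * eps.
Proof.
unfold elasticity; rewrite acclimated_mp, acclimated_fair; field; lra.
Qed.

Lemma acclimated_markup : markup C P = 1 + 1 / ((1 + gamma * theta) * eps - 1).
Proof.
destruct Hacc as [_ [Hopt _]].
apply optimal_price_iff in Hopt as [HP [HF HE]]; auto.
assert (Hgt : 0 < gamma * theta) by nra.
assert (H : C = P * (1 - 1 / ((1 + gamma * theta) * eps))).
{ rewrite <- acclimated_elasticity, <- (exp_ln C), <- HE by easy.
  rewrite exp_log_cost, exp_ln by easy; reflexivity. }
unfold markup; rewrite H; field; repeat split; nra.
Qed.

Lemma acclimated_is_passthrough :
  is_passthrough eps theta gamma C Cb (acclimated_passthrough eps theta gamma).
Proof.
assert (HF : 0 < fair eps theta gamma Cb (ln P))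
  by (rewrite acclimated_fair; lra).
assert (Hgt : 0 < gamma * theta) by nra.
assert (Hd := is_derive_log_cost eps theta gamma Cb Heps Htheta Hgamma _ _ HF
  (is_derive_elasticity eps theta gamma Cb Heps _ HF)).
rewrite acclimated_elasticity, acclimated_fair, acclimated_mp in Hd.
unfold acclimated_passthrough, Rdiv at 1; rewrite Rmult_1_l.
apply is_passthrough_inv_log_cost with P; auto.
- apply Hacc.
- apply Rplus_lt_0_compat, Rdiv_lt_0_compat; [lra | |].
  + repeat apply Rmult_lt_0_compat; try lra; nra.
  + repeat apply Rmult_lt_0_compat; nra.
(* Here [E' = gamma ^ 2 * theta * eps * ((1 + theta) * eps - 1) / (eps - 1)]; its factor [eps]
   cancels against the one in [E * (E - 1)]. *)
- evar_last; [exact Hd|].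
  field; repeat split; nra.
Qed.

Lemma acclimated_passthrough_eq (beta : R) :
  is_passthrough eps theta gamma C Cb beta ->
  beta = acclimated_passthrough eps theta gamma.
Proof.
intros H; apply (is_passthrough_unique eps theta gamma C Cb); auto.
apply acclimated_is_passthrough.
Qed.

End Acclimated.

(** * Comparative statics of the two formulas *)

(** Here [a] and [b] stand for values of [(1 + gamma * theta) * eps], the only channel through which
    the parameters enter the markup. *)
Lemma markup_formula_lt (a b : R) :
  1 < a -> a < b -> 1 + 1 / (b - 1) < 1 + 1 / (a - 1).
Proof.
intros Ha Hab; apply Rplus_lt_compat_l; unfold Rdiv; rewrite !Rmult_1_l.
apply Rinv_lt_contravar; nra.
Qed.

Lemma Rdiv_lt_cross (a b c d : R) :
  0 < b -> 0 < d -> a * d < c * b -> a / b < c / d.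
Proof.
intros Hb Hd H.
apply Rmult_lt_reg_r with (b * d); [nra|].
replace (a / b * (b * d)) with (a * d) by (field; lra).
replace (c / d * (b * d)) with (c * b) by (field; lra).
easy.
Qed.

Lemma Rdiv_le_cross (a b c d : R) :
  0 < b -> 0 < d -> a * d <= c * b -> a / b <= c / d.
Proof.
intros Hb Hd H.
apply Rmult_le_reg_r with (b * d); [nra|].
replace (a / b * (b * d)) with (a * d) by (field; lra).
replace (c / d * (b * d)) with (c * b) by (field; lra).
easy.
Qed.

(** For each parameter the correction term is split into two factors that move the same way, one
    strictly and the other at least weakly. *)
Lemma passthrough_formula_lt (u v u' v' : R) :
  0 <= u -> 0 <= v -> u < u' -> v <= v' -> 0 < v' ->
  1 / (1 + u' * v') < 1 / (1 + u * v).
Proof.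
intros Hu Hv Huu Hvv Hv'.
unfold Rdiv; rewrite !Rmult_1_l.
assert (u * v < u' * v') by nra.
assert (0 <= u * v) by nra.
apply Rinv_lt_contravar; nra.
Qed.

Lemma acclimated_passthrough_eps (eps eps' theta gamma : R) :
  1 < eps -> 0 < theta -> 0 < gamma -> eps < eps' ->
  acclimated_passthrough eps theta gamma <
  acclimated_passthrough eps' theta gamma.
Proof.
intros He Ht Hg Hee.
assert (Hgt : 0 < gamma * theta) by nra.
(* Writing [((1 + theta) * e - 1) / (e - 1)] as [1 + theta * e / (e - 1)] shows that it decreases in
   [e]; the second factor is free of [e]. *)
assert (E : forall e, 1 < e -> acclimated_passthrough e theta gamma =
  1 / (1 + (1 + theta * e / (e - 1)) / ((1 + gamma * theta) * e - 1)
         * (gamma ^ 2 * theta / (1 + gamma * theta)))).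
{ intros e H; unfold acclimated_passthrough; do 2 f_equal.
  field; repeat split; nra. }
rewrite !E by lra.
assert (Hk : 0 < gamma ^ 2 * theta / (1 + gamma * theta))
  by (apply Rdiv_lt_0_compat; [apply Rmult_lt_0_compat; nra | lra]).
assert (H1 : theta * eps' / (eps' - 1) < theta * eps / (eps - 1))
  by (apply Rdiv_lt_cross; nra).
assert (H2 : 0 < theta * eps' / (eps' - 1))
  by (apply Rdiv_lt_0_compat; nra).
assert (H3 : 0 < (1 + gamma * theta) * eps - 1) by nra.
assert (H4 : (1 + gamma * theta) * eps - 1 < (1 + gamma * theta) * eps' - 1)
  by nra.
apply passthrough_formula_lt; try lra.
- left; apply Rdiv_lt_0_compat; lra.
- apply Rdiv_lt_cross; [lra | lra | nra].
Qed.

Lemma acclimated_passthrough_theta (eps theta theta' gamma : R) :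
  1 < eps -> 0 < theta -> 0 < gamma -> gamma <= 1 -> theta < theta' ->
  acclimated_passthrough eps theta' gamma <
  acclimated_passthrough eps theta gamma.
Proof.
intros He Ht Hg Hg1 Htt.
assert (E : forall t, 0 < t -> acclimated_passthrough eps t gamma =
  1 / (1 + (gamma ^ 2 / (eps - 1) * (t / (1 + gamma * t)))
         * (((1 + t) * eps - 1) / ((1 + gamma * t) * eps - 1)))).
{ intros t H; assert (0 < gamma * t) by nra.
  unfold acclimated_passthrough; do 2 f_equal.
  field; repeat split; nra. }
rewrite !E by lra.
assert (Hgt : 0 < gamma * theta < gamma * theta') by nra.
assert (Hk : 0 < gamma ^ 2 / (eps - 1)) by (apply Rdiv_lt_0_compat; nra).
assert (H1 : 0 < theta / (1 + gamma * theta)) by (apply Rdiv_lt_0_compat; lra).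
assert (H2 : 0 < (1 + gamma * theta) * eps - 1) by nra.
assert (H3 : 0 < (1 + gamma * theta') * eps - 1) by nra.
assert (H4 : theta / (1 + gamma * theta) < theta' / (1 + gamma * theta'))
  by (apply Rdiv_lt_cross; nra).
apply passthrough_formula_lt.
- nra.
- left; apply Rdiv_lt_0_compat; nra.
- now apply Rmult_lt_compat_l.
- apply Rdiv_le_cross; [lra | lra |].
  (* This product is the difference of the cross products. It vanishes at [gamma = 1], so strictness
     must come from the factor [t / (1 + gamma * t)]. *)
  enough (0 <= eps * (eps - 1) * (1 - gamma) * (theta' - theta)) by nra.
  repeat apply Rmult_le_pos; lra.
- apply Rdiv_lt_0_compat; nra.
Qed.

Lemma acclimated_passthrough_gamma (eps theta gamma gamma' : R) :
  1 < eps -> 0 < theta -> 0 < gamma -> gamma < gamma' ->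
  acclimated_passthrough eps theta gamma' <
  acclimated_passthrough eps theta gamma.
Proof.
intros He Ht Hg Hgg.
(* The square of [g] is shared out, one [g] over each denominator, so that both quotients increase
   in [g]. *)
assert (E : forall g, 0 < g -> acclimated_passthrough eps theta g =
  1 / (1 + (theta * ((1 + theta) * eps - 1) / (eps - 1)
              * (g / (1 + g * theta)))
         * (g / ((1 + g * theta) * eps - 1)))).
{ intros g H; assert (0 < g * theta) by nra.
  unfold acclimated_passthrough; do 2 f_equal.
  field; repeat split; nra. }
rewrite !E by lra.
assert (Hgt : 0 < gamma * theta < gamma' * theta) by nra.
assert (Hk : 0 < theta * ((1 + theta) * eps - 1) / (eps - 1))
  by (apply Rdiv_lt_0_compat; [apply Rmult_lt_0_compat; nra | lra]).
assert (H1 : 0 < gamma / (1 + gamma * theta)) by (apply Rdiv_lt_0_compat; lra).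
assert (H2 : 0 < (1 + gamma * theta) * eps - 1) by nra.
assert (H3 : 0 < (1 + gamma' * theta) * eps - 1) by nra.
assert (H4 : gamma / (1 + gamma * theta) < gamma' / (1 + gamma' * theta))
  by (apply Rdiv_lt_cross; nra).
apply passthrough_formula_lt.
- nra.
- left; apply Rdiv_lt_0_compat; nra.
- now apply Rmult_lt_compat_l.
- apply Rdiv_le_cross; [lra | lra | nra].
- apply Rdiv_lt_0_compat; lra.
Qed.

(** * The closed forms and their monotonicity, with the prior re-acclimated at each parameter
    value *)

Theorem corollary1 (eps theta gamma C Cb P : R)
  (Heps : 1 < eps) (Htheta : 0 < theta)
  (Hgamma0 : 0 < gamma) (Hgamma1 : gamma <= 1) (HC : 0 < C)
  (Hacc : acclimated eps theta gamma C Cb P) :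
  markup C P = 1 + 1 / ((1 + gamma * theta) * eps - 1)
  /\ (forall eps' Cb' P' : R, eps < eps' ->
        acclimated eps' theta gamma C Cb' P' -> markup C P' < markup C P)
  /\ (forall theta' Cb' P' : R, theta < theta' ->
        acclimated eps theta' gamma C Cb' P' -> markup C P' < markup C P)
  /\ (forall gamma' Cb' P' : R, gamma < gamma' -> gamma' <= 1 ->
        acclimated eps theta gamma' C Cb' P' -> markup C P' < markup C P)
  /\ is_passthrough eps theta gamma C Cb
       (1 / (1 + gamma ^ 2 * theta * ((1 + theta) * eps - 1)
                 / ((eps - 1) * (1 + gamma * theta)
                    * ((1 + gamma * theta) * eps - 1))))
  /\ (forall eps' Cb' P' beta beta' : R, eps < eps' ->
        acclimated eps' theta gamma C Cb' P' ->
        is_passthrough eps theta gamma C Cb beta ->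
        is_passthrough eps' theta gamma C Cb' beta' -> beta < beta')
  /\ (forall theta' Cb' P' beta beta' : R, theta < theta' ->
        acclimated eps theta' gamma C Cb' P' ->
        is_passthrough eps theta gamma C Cb beta ->
        is_passthrough eps theta' gamma C Cb' beta' -> beta' < beta)
  /\ (forall gamma' Cb' P' beta beta' : R, gamma < gamma' -> gamma' <= 1 ->
        acclimated eps theta gamma' C Cb' P' ->
        is_passthrough eps theta gamma C Cb beta ->
        is_passthrough eps theta gamma' C Cb' beta' -> beta' < beta).
Proof.
assert (Hgt : 0 < gamma * theta) by nra.
assert (HE : 1 < (1 + gamma * theta) * eps) by nra.
split; [|split; [|split; [|split; [|split; [|split; [|split]]]]]].
- now apply acclimated_markup with Cb.
- intros eps' Cb' P' Hlt Hacc'.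
  rewrite (acclimated_markup eps theta gamma C Cb P) by easy.
  rewrite (acclimated_markup eps' theta gamma C Cb' P') by (easy || lra).
  apply markup_formula_lt; [easy | apply Rmult_lt_compat_l; lra].
- intros theta' Cb' P' Hlt Hacc'.
  rewrite (acclimated_markup eps theta gamma C Cb P) by easy.
  rewrite (acclimated_markup eps theta' gamma C Cb' P') by (easy || lra).
  assert (gamma * theta < gamma * theta') by now apply Rmult_lt_compat_l.
  apply markup_formula_lt; [easy | apply Rmult_lt_compat_r; lra].
- intros gamma' Cb' P' Hlt _ Hacc'.
  rewrite (acclimated_markup eps theta gamma C Cb P) by easy.
  rewrite (acclimated_markup eps theta gamma' C Cb' P') by (easy || lra).
  assert (gamma * theta < gamma' * theta) by now apply Rmult_lt_compat_r.
  apply markup_formula_lt; [easy | apply Rmult_lt_compat_r; lra].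
- now apply acclimated_is_passthrough with P.
- intros eps' Cb' P' beta beta' Hlt Hacc' Hb Hb'.
  rewrite (acclimated_passthrough_eq eps theta gamma C Cb P) with beta by easy.
  rewrite (acclimated_passthrough_eq eps' theta gamma C Cb' P') with beta'
    by (easy || lra).
  now apply acclimated_passthrough_eps.
- intros theta' Cb' P' beta beta' Hlt Hacc' Hb Hb'.
  rewrite (acclimated_passthrough_eq eps theta gamma C Cb P) with beta by easy.
  rewrite (acclimated_passthrough_eq eps theta' gamma C Cb' P') with beta'
    by (easy || lra).
  now apply acclimated_passthrough_theta.
- intros gamma' Cb' P' beta beta' Hlt _ Hacc' Hb Hb'.
  rewrite (acclimated_passthrough_eq eps theta gamma C Cb P) with beta by easy.
  rewrite (acclimated_passthrough_eq eps theta gamma' C Cb' P') with beta'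
    by (easy || lra).
  now apply acclimated_passthrough_gamma.
Qed.
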